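(* Let $\mathcal D\subseteq(0,1)$ be nonempty and let $f:\mathcal D\to(0,1)$. Then there exists a finite automaton that simulates $f$ (i.e. for every $p\in\mathcal D$ it outputs an $f(p)$-coin from independent tosses of a $p$-coin) if and only if there is a rational function $F\in\mathbb Q(x)$ such that $F$ is defined and satisfies $0<F(x)<1$ for all $x\in(0,1)$, and $F(p)=f(p)$ for all $p\in\mathcal D$.
   Context: For a finite binary string $w\in\{0,1\}^*$ let $n_i(w)$ be the number of occurrences of the symbol $i$ in $w$, and for $p\in(0,1)$ set $\mathbf P_p[w]=p^{n_1(w)}(1-p)^{n_0(w)}$ and $\mathbf P_p[L]=\sum_{w\in L}\mathbf P_p[w]$ for a language $L\subseteq\{0,1\}^*$. A language is prefix-free if no string in it is a proper prefix of another string in it. For $\mathcal D\subseteq(0,1)$ and $f:\mathcal D\to[0,1]$, a simulation of $f$ is a pair of disjoint languages $L_0,L_1\subseteq\{0,1\}^*$ such that $L_0\cup L_1$ is prefix-free and, for every $p\in\mathcal D$, $\mathbf P_p[L_0\cup L_1]=1$ and $\mathbf P_p[L_1]=f(p)$. A finite automaton consists of a finite set of states $S$, a start state $s_0\in S$, a transition function $\delta:S\times\{0,1\}\to S$ (extended to strings by $\delta(s,w_1\cdots w_k)=\delta(\delta(s,w_1),w_2\cdots w_k)$), and two disjoint sets of final states $S_0,S_1\subseteq S$ which are absorbing ($\delta(s,b)=s$ for $s\in S_0\cup S_1$). Let $L_i$ be the set of strings $w$ such that $\delta(s_0,w)\in S_i$ but $\delta(s_0,w')\notin S_0\cup S_1$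 for every proper prefix $w'$ of $w$ (the automaton stops and outputs $i$). The automaton simulates $f$ if $(L_0,L_1)$ is a simulation of $f$. *)

(* Defs.v *)
From HB Require Import structures.
From mathcomp Require Import all_boot all_order all_algebra.
From mathcomp Require Import all_classical all_reals all_analysis.
Set Implicit Arguments. Unset Strict Implicit. Unset Printing Implicit Defensive.
Import Order.TTheory GRing.Theory Num.Theory.
Local Open Scope ring_scope.

(* Binary strings are [seq bool] (true = symbol 1, false = symbol 0). *)
Definition n1 (w : seq bool) : nat := count id w.
Definition n0 (w : seq bool) : nat := count negb w.

Definition wprob (R : realType) (p : R) (w : seq bool) : R :=
  p ^+ n1 w * (1 - p) ^+ n0 w.

Definition language := pred (seq bool).

(* P_p[L] = sum_{w in L} P_p[w], computed as the (nonnegative, extended-real)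
   series over lengths k of the finite sums over strings of length k in L. *)
Definition lang_prob (R : realType) (p : R) (L : language) : \bar R :=
  (\sum_(0 <= k <oo) (\sum_(t : k.-tuple bool | L t) wprob p t)%:E)%E.

Definition prefix_free (L : language) : Prop :=
  forall u v, L u -> L v -> prefix u v -> u = v.

Definition simulation (R : realType) (D : set R) (f : R -> R)
    (L0 L1 : language) : Prop :=
  (forall w, ~~ (L0 w && L1 w)) /\
  prefix_free (predU L0 L1) /\
  (forall p, D p -> lang_prob p (predU L0 L1) = 1%:E /\
                    lang_prob p L1 = (f p)%:E).

Record automaton := Automaton {
  state : finType;
  s0 : state;
  delta : state -> bool -> state;
  S0 : {set state};
  S1 : {set state};
  final_disjoint : [disjoint S0 & S1];
  final_absorbing : forall s b, s \in S0 :|: S1 -> delta s b = s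
}.

Definition run (A : automaton) (s : state A) (w : seq bool) : state A :=
  foldl (@delta A) s w.

Definition stopped (A : automaton) (w : seq bool) : bool :=
  run (s0 A) w \in S0 A :|: S1 A.

Definition aut_lang (A : automaton) (i : bool) : language :=
  fun w => (run (s0 A) w \in (if i then S1 A else S0 A)) &&
           all (fun k => ~~ stopped A (take k w)) (iota 0 (size w)).

Definition aut_simulates (R : realType) (A : automaton) (D : set R)
    (f : R -> R) : Prop :=
  simulation D f (aut_lang A false) (aut_lang A true).

Definition ratfun_eval (R : realType) (P Q : {poly rat}) (x : R) : R :=
  (map_poly (ratr : rat -> R) P).[x] / (map_poly (ratr : rat -> R) Q).[x].

Definition ratfun_defined (R : realType) (Q : {poly rat}) (x : R) : Prop :=
  (map_poly (ratr : rat -> R) Q).[x] != 0.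

(* Main.v *)
(** If the automaton starts in a state [s], the probabilities [h s] of ever
    reaching a given set of final states solve the linear system
    [h s = x h(delta s 1) + (1 - x) h(delta s 0)], whose coefficients are integer
    polynomials in [x].  By the maximum principle it is nonsingular on (0, 1) once
    the states from which no final state is reachable are discarded, so Cramer's
    rule makes [h] a rational function; it is positive there because one accepted
    word has positive probability for every [x] in (0, 1).

    Conversely, write F = P / (P + G) with P and G positive polynomials on (0, 1).
    After splitting off factors [x] and [1 - x], a high enough degree elevation
    makes all Bernstein coefficients nonnegative, so that an integer multiple of P
    (resp. G) is the sum of the probabilities of a list of words of a common
    length.  Appending to these words distinct suffixes with M zeros and M ones
    makes them distinct and multiplies both sums by the same [(x (1 - x))^M].  The
    automaton reads blocks of that length, outputs 1 (resp. 0) on the words of the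
    first (resp. second) list, and starts again otherwise. *)

Require Import Defs.
From HB Require Import structures.
From mathcomp Require Import all_boot all_order all_algebra.
From mathcomp Require Import all_classical all_reals all_analysis.
From mathcomp Require Import zify ring lra.
Set Implicit Arguments.
Unset Strict Implicit.
Unset Printing Implicit Defensive.
Import Order.TTheory GRing.Theory Num.Theory.
Import numFieldNormedType.Exports.
Local Open Scope ring_scope.

(** * Absorption probabilities of an automaton *)

Lemma wprob_nil (R : realType) (x : R) : wprob x [::] = 1.
Proof. by rewrite /wprob /= !expr0 mul1r. Qed.

Lemma wprob_cons (R : realType) (x : R) b w :
  wprob x (b :: w) = (if b then x else 1 - x) * wprob x w.
Proof. by rewrite /wprob /n1 /n0; case: b; rewrite /= add1n add0n exprS; ring. Qed.

Lemma wprob_cat (R : realType) (x : R) u v :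
  wprob x (u ++ v) = wprob x u * wprob x v.
Proof.
by elim: u => [|b u IHu]; rewrite ?wprob_nil ?mul1r //= !wprob_cons IHu mulrA.
Qed.

Lemma wprob_gt0 (R : realType) (x : R) w : 0 < x < 1 -> 0 < wprob x w.
Proof. by move=> /andP[x0 x1]; rewrite mulr_gt0 ?exprn_gt0 ?subr_gt0. Qed.

Lemma sum_tuple_cons (V : nmodType) k (F : seq bool -> V) (P : pred (seq bool)) :
  \sum_(t : k.+1.-tuple bool | P t) F t =
  \sum_(t : k.-tuple bool | P (true :: t)) F (true :: t) +
  \sum_(t : k.-tuple bool | P (false :: t)) F (false :: t).
Proof.
pose h (u : bool * k.-tuple bool) : k.+1.-tuple bool := [tuple of u.1 :: u.2].
have hbij : bijective h.
  exists (fun t => (thead t, [tuple of behead t])) => [[b t]|t].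
    by congr pair; apply: val_inj.
  by rewrite [RHS]tuple_eta; apply: val_inj.
rewrite (reindex h) /=; last exact: onW_bij.
rewrite -(pair_big_dep xpredT (fun b t => P (b :: tval t))
  (fun b (t : k.-tuple bool) => F (b :: t))) /=.
by rewrite big_bool.
Qed.

Lemma sum_tuple0 (V : nmodType) (F : seq bool -> V) (P : pred (seq bool)) :
  \sum_(t : 0.-tuple bool | P t) F t = if P [::] then F [::] else 0.
Proof.
rewrite big_mkcond (big_pred1 [tuple]) // => t.
by apply/esym/eqP; rewrite [LHS]tuple0.
Qed.

Lemma sum_wprob_tuple (R : realType) (x : R) k :
  \sum_(t : k.-tuple bool) wprob x t = 1.
Proof.
elim: k => [|k IHk].
  by rewrite (@sum_tuple0 _ (wprob x) xpredT) wprob_nil.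
rewrite (@sum_tuple_cons _ _ (wprob x) xpredT).
under eq_bigr do rewrite wprob_cons.
under [X in _ + X]eq_bigr do rewrite wprob_cons.
by rewrite -!mulr_sumr IHk; ring.
Qed.

Definition final (A : automaton) : {set state A} := S0 A :|: S1 A.

(** Start and target are free: conditioning on the first toss moves the start, and the target is
    [S0 A], [S1 A] or their union. *)
Definition hits (A : automaton) (B : {set state A}) (s : state A) (w : seq bool) :=
  (run s w \in B) && all (fun k => run s (take k w) \notin final A) (iota 0 (size w)).

Lemma hits_cons (A : automaton) (B : {set state A}) s b w :
  hits B s (b :: w) = (s \notin final A) && hits B (delta s b) w.
Proof.
rewrite /hits /= -(addn0 1%N) iotaDl all_map andbCA; congr (_ && (_ && _)).
Qed.

(** The chance of stopping in [B] after at most [n] tosses, by conditioning on the first toss, so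
    that the harmonic equation passes to the limit. *)
Fixpoint hit_prob (R : realType) (A : automaton) (x : R) (B : {set state A}) n s : R :=
  (s \in B)%:R +
  if n is m.+1 then
    (s \notin final A)%:R *
      (x * hit_prob x B m (delta s true) + (1 - x) * hit_prob x B m (delta s false))
  else 0.

Lemma hit_probE (R : realType) (A : automaton) (x : R) (B : {set state A}) n s :
  hit_prob x B n s =
  \sum_(k < n.+1) \sum_(t : k.-tuple bool | hits B s t) wprob x t.
Proof.
have h0 s' : \sum_(t : 0.-tuple bool | hits B s' t) wprob x t = (s' \in B)%:R.
  rewrite (@sum_tuple0 _ (wprob x) (hits B s')) /hits /= andbT wprob_nil.
  by case: (s' \in B).
elim: n s => [|n IHn] s; first by rewrite big_ord1 h0 /= addr0.
rewrite big_ord_recl h0 /=; congr (_ + _).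
rewrite !IHn !mulr_sumr -big_split mulr_sumr; apply: eq_bigr => k _ /=.
rewrite (@sum_tuple_cons _ _ (wprob x) (hits B s)).
have [sF|sF] /= := boolP (s \in final A).
  by rewrite mul0r !big_pred0 ?addr0 // => t; rewrite hits_cons sF.
rewrite mul1r; congr (_ + _); rewrite mulr_sumr;
  by apply: eq_big => [t|t _]; rewrite ?hits_cons ?sF ?wprob_cons.
Qed.

Lemma hit_prob_le1 (R : realType) (A : automaton) (x : R) (B : {set state A}) n s :
  0 < x < 1 -> B \subset final A -> hit_prob x B n s <= 1.
Proof.
move=> /andP[x0 x1] /fintype.subsetP BF; elim: n s => [|n IHn] s /=.
  by rewrite addr0; case: (s \in B); rewrite ?ler01.
have := IHn (delta s true); have := IHn (delta s false).
have [sF|sF] /= := boolP (s \in final A).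
  by rewrite mul0r addr0; case: (s \in B); rewrite ?ler01.
have /negPf -> : s \notin B by apply: contra sF; exact: BF.
by rewrite add0r mul1r; nra.
Qed.

Lemma hit_probU (R : realType) (A : automaton) (x : R) n s :
  hit_prob x (S0 A) n s + hit_prob x (S1 A) n s = hit_prob x (final A) n s.
Proof.
have E s' : (s' \in S0 A)%:R + (s' \in S1 A)%:R = (s' \in final A)%:R :> R.
  rewrite finset.in_setU; have := disjointFr (final_disjoint A) (x := s').
  by case: (s' \in S0 A) => /= [->|] //; rewrite ?addr0 ?add0r.
elim: n s => [|n IHn] s /=; first by rewrite !addr0 E.
by rewrite -E -!IHn; ring.
Qed.

Lemma hit_prob_nondecreasing (R : realType) (A : automaton) (x : R)
    (B : {set state A}) s :
  0 < x < 1 -> nondecreasing_seq (fun n => hit_prob x B n s).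
Proof.
move=> x01; apply/nondecreasing_seqP => n.
rewrite !hit_probE [leRHS]big_ord_recr /= lerDl sumr_ge0 // => t _.
by rewrite ltW ?wprob_gt0.
Qed.

Lemma hit_prob_is_cvg (R : realType) (A : automaton) (x : R) (B : {set state A}) s :
  0 < x < 1 -> B \subset final A -> cvgn (fun n => hit_prob x B n s).
Proof.
move=> x01 BF; apply: nondecreasing_is_cvgn; first exact: hit_prob_nondecreasing.
by exists 1 => _ [n _ <-]; exact: hit_prob_le1.
Qed.

Definition hit_lim (R : realType) (A : automaton) (x : R) (B : {set state A}) s : R :=
  limn (fun n => hit_prob x B n s).

Lemma lang_prob_hits (R : realType) (A : automaton) (x : R) (B : {set state A}) s L :
  0 < x < 1 -> B \subset final A -> L =1 hits B s ->
  lang_prob x L = (hit_lim x B s)%:E.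
Proof.
(* The shift by one matches indices: the partial sum over lengths below [n.+1] is [hit_prob] at
   [n]. *)
move=> x01 BF LE; apply/cvg_lim => //; rewrite -cvg_shiftS /=.
rewrite (_ : (fun n => _) = EFin \o (fun n => hit_prob x B n s)).
  by apply: cvg_EFin; [exact: nearW | exact: hit_prob_is_cvg].
apply/funext => n /=; rewrite hit_probE sumEFin big_mkord; congr EFin.
by apply: eq_bigr => k _; apply: eq_bigl => t; rewrite LE.
Qed.

Lemma hit_lim_rec (R : realType) (A : automaton) (x : R) (B : {set state A}) s :
  0 < x < 1 -> B \subset final A ->
  hit_lim x B s = (s \in B)%:R + (s \notin final A)%:R *
    (x * hit_lim x B (delta s true) + (1 - x) * hit_lim x B (delta s false)).
Proof.
move=> x01 BF; have cv s' : cvgn (fun n => hit_prob x B n s') by exact: hit_prob_is_cvg.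
apply/cvg_lim => //; rewrite -cvg_shiftS /=.
apply: cvgD; first exact: cvg_cst.
apply: cvgMr.
by apply: cvgD; apply: cvgMr; exact: cv.
Qed.

(** The word does not depend on [x], so one accepted word found at a single point gives positivity
    on all of (0, 1). *)
Lemma wprob_le_hit_lim (R : realType) (A : automaton) (x : R) (B : {set state A}) s w :
  0 < x < 1 -> B \subset final A -> hits B s w -> wprob x w <= hit_lim x B s.
Proof.
move=> x01 BF hw.
apply: le_trans (nondecreasing_cvgn_le (hit_prob_nondecreasing B s x01)
  (hit_prob_is_cvg x01 BF) (size w)).
rewrite hit_probE big_ord_recr /= ler_wpDl //.
  rewrite sumr_ge0 // => k _.
  by rewrite sumr_ge0 // => t _; rewrite ltW ?wprob_gt0.
rewrite (bigD1 (in_tuple w)) //= lerDl.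
by rewrite sumr_ge0 // => t _; rewrite ltW ?wprob_gt0.
Qed.

Lemma hit_limU (R : realType) (A : automaton) (x : R) s : 0 < x < 1 ->
  hit_lim x (S0 A) s + hit_lim x (S1 A) s = hit_lim x (final A) s.
Proof.
move=> x01; rewrite /hit_lim -limD.
- by congr (limn _); apply/funext => n; exact: hit_probU.
- by apply: hit_prob_is_cvg => //; exact: finset.subsetUl.
- by apply: hit_prob_is_cvg => //; exact: finset.subsetUr.
Qed.

Lemma hit_lim_le1 (R : realType) (A : automaton) (x : R) (B : {set state A}) s :
  0 < x < 1 -> B \subset final A -> hit_lim x B s <= 1.
Proof.
move=> x01 BF; apply: limr_le; first exact: hit_prob_is_cvg.
by apply: nearW => n; exact: hit_prob_le1.
Qed.

Lemma aut_lang0E (A : automaton) : aut_lang A false =1 hits (S0 A) (s0 A).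
Proof. by []. Qed.

Lemma aut_lang1E (A : automaton) : aut_lang A true =1 hits (S1 A) (s0 A).
Proof. by []. Qed.

Lemma aut_langUE (A : automaton) :
  predU (aut_lang A false) (aut_lang A true) =1 hits (final A) (s0 A).
Proof. by move=> w; rewrite /= /aut_lang -andb_orl -finset.in_setU. Qed.

Lemma aut_lang_disjoint (A : automaton) w :
  ~~ (aut_lang A false w && aut_lang A true w).
Proof.
apply/negP => /andP[/andP[w0 _] /andP[w1 _]].
by rewrite (disjointFr (final_disjoint A) w0) in w1.
Qed.

Lemma aut_lang_prefix_free (A : automaton) :
  prefix_free (predU (aut_lang A false) (aut_lang A true)).
Proof.
move=> u v; rewrite !aut_langUE => /andP[uF _] /andP[_ /allP vN] uv.
move: (uv); rewrite prefixE => /eqP vu; apply/eqP; move: (size_prefix uv).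
rewrite leq_eqVlt => /orP[/eqP suv|suv]; first by rewrite -vu suv take_size.
have := vN (size u); rewrite mem_iota add0n suv vu uF.
by move/(_ isT).
Qed.

(** * Rationality by Cramer's rule *)

(** Bundled as a ring morphism so that evaluation commutes with determinants, adjugates and matrix
    products. *)
Definition rat_eval (R : realType) (x : R) : {rmorphism {poly rat} -> R} :=
  horner_eval x \o map_poly (ratr : rat -> R).

Lemma rat_evalX (R : realType) (x : R) : rat_eval x 'X = x.
Proof. by rewrite /= map_polyX /horner_eval hornerX. Qed.

Definition active (A : automaton) (s : state A) : bool :=
  (s \notin final A) && `[< exists w, run s w \in final A >].

(* States from which no final state is reachable get a trivial row: with the
   harmonic equation there, the matrix would be singular. *)
Definition hit_matrix (A : automaton) : 'M[{poly rat}]_#|state A| :=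
  \matrix_(i, j) ((enum_val i == enum_val j)%:R -
    (active (enum_val i))%:R * ('X * (delta (enum_val i) true == enum_val j)%:R +
      (1 - 'X) * (delta (enum_val i) false == enum_val j)%:R)).

Definition hit_target (A : automaton) (B : {set state A}) : 'cV[{poly rat}]_#|state A| :=
  \col_i (enum_val i \in B)%:R.

Lemma sum_indicator (R : pzSemiRingType) (T : finType) (t : T) (u : T -> R) :
  \sum_s (t == s)%:R * u s = u t.
Proof.
rewrite (bigD1 t) //= eqxx mul1r big1 ?addr0 // => s.
by rewrite eq_sym => /negPf->; rewrite mul0r.
Qed.

Lemma hit_matrix_mul (R : realType) (A : automaton) (x : R) (u : state A -> R) i :
  let s := enum_val i in
  (map_mx (rat_eval x) (hit_matrix A) *m \col_j u (enum_val j)) i 0 =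
  u s - (active s)%:R * (x * u (delta s true) + (1 - x) * u (delta s false)).
Proof.
move=> s; rewrite mxE.
under eq_bigr do rewrite !mxE rmorphB !rmorphM rmorphD !rmorphM rmorphB rmorph1
  !rmorph_nat rat_evalX.
rewrite -(big_enum_val (A := state A) (fun j => ((s == j)%:R - (active s)%:R *
  (x * (delta s true == j)%:R + (1 - x) * (delta s false == j)%:R)) * u j)) /=.
rewrite -[in RHS](sum_indicator s u) -(sum_indicator (delta s true) u).
rewrite -(sum_indicator (delta s false) u) !mulr_sumr -big_split /=.
rewrite mulr_sumr -sumrB; apply: eq_bigr => j _; ring.
Qed.

(** Maximum principle: at an active state where [|u|] is maximal, the equation is a convex
    combination with positive weights, so both successors attain the maximum too. Following a word
    to a final state meets an inactive state, where [u] vanishes. *)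
Lemma active_harmonic_eq0 (R : realType) (A : automaton) (x : R) (u : state A -> R) :
  0 < x < 1 ->
  (forall s, u s = (active s)%:R * (x * u (delta s true) + (1 - x) * u (delta s false))) ->
  forall s, u s = 0.
Proof.
move=> /andP[x0 x1] uE s.
pose m := [arg max_(t > s) `|u t|]%O.
have um t : `|u t| <= `|u m|.
  by rewrite /m; case: Order.TotalTheory.arg_maxP => // i _; apply.
suff m0 : u m = 0 by move: (um s); rewrite m0 normr0 normr_le0 => /eqP.
have key w t : run t w \in final A -> `|u t| = `|u m| -> u m = 0.
  elim: w t => [|b w IHw] t /= tF tm.
    apply/eqP; rewrite -normr_eq0 -tm uE /active tF mul0r normr0 eqxx //.
  have := uE t; have [ta|] := boolP (active t); last first.
    by move=> _; rewrite mul0r => ut0; apply/eqP; rewrite -normr_eq0 -tm ut0 normr0.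
  rewrite mul1r => ut.
  apply: (IHw (delta t b)) => //; apply/eqP; rewrite eq_le um /=.
  have := um (delta t true); have := um (delta t false).
  have : `|u m| <= x * `|u (delta t true)| + (1 - x) * `|u (delta t false)|.
    rewrite -tm ut (le_trans (ler_normD _ _)) // !normrM.
    by rewrite (gtr0_norm x0) (@gtr0_norm _ (1 - x)) ?subr_gt0.
  by case: b {tF}; nra.
have [ma|/negPf ma] := boolP (active m); last by rewrite uE ma mul0r.
by case/andP: ma => _ /asboolP[w wF]; exact: (key w m).
Qed.

Lemma hit_matrix_det_neq0 (R : realType) (A : automaton) (x : R) :
  0 < x < 1 -> rat_eval x (\det (hit_matrix A)) != 0.
Proof.
(* [det0P] yields a row vector; transposing first turns it into a column in the kernel of the matrix
   itself. *)
move=> x01; rewrite -det_map_mx -det_tr; apply/det0P => -[v v0 vM].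
move/eqP: v0; apply; apply/matrixP => i j; rewrite ord1 !mxE.
pose u s := v 0 (enum_rank s).
rewrite -(enum_valK j); apply: (@active_harmonic_eq0 R A x u) => // s.
have vE : v^T = \col_j u (enum_val j).
  by apply/matrixP => a b; rewrite !mxE ord1 /u enum_valK.
have := congr1 trmx vM; rewrite trmx_mul trmxK vE trmx0.
move/matrixP/(_ (enum_rank s) 0); rewrite hit_matrix_mul mxE enum_rankK.
by move/eqP; rewrite subr_eq0 => /eqP.
Qed.

(** Justifies the trivial rows of [hit_matrix]: a final state has its indicator as value, and from a
    state that cannot reach a final one every [hit_prob] is zero. *)
Lemma hit_lim_inactive (R : realType) (A : automaton) (x : R) (B : {set state A}) s :
  0 < x < 1 -> B \subset final A -> ~~ active s -> hit_lim x B s = (s \in B)%:R.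
Proof.
move=> x01 BF; have [sF _|sF] := boolP (s \in final A).
  by rewrite hit_lim_rec // sF mul0r addr0.
rewrite /active sF /= => /asboolP sN.
have B0 t : t \notin final A -> (t \in B) = false.
  by move=> tF; apply/negbTE; apply: contra tF; exact: (fintype.subsetP BF).
rewrite B0 // /hit_lim (_ : (fun n => _) = fun=> 0); first exact: lim_cst.
apply/funext => n; elim: n s sN {sF} => [|n IHn] s sN /=;
  have sF : s \notin final A by apply/negP => sF; apply: sN; exists [::].
  by rewrite B0 // addr0.
rewrite B0 // sF !IHn ?(mulr0, addr0) // => -[w wF]; apply: sN.
  by exists (false :: w).
by exists (true :: w).
Qed.

(** Cramer's rule: multiplying the linear system by the adjugate leaves the determinant times the
    vector of limits. *)
Lemma hit_lim_ratfun (R : realType) (A : automaton) (B : {set state A}) s (x : R) :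
  B \subset final A -> 0 < x < 1 ->
  let P := (\adj (hit_matrix A) *m hit_target B) (enum_rank s) 0 in
  ratfun_defined (\det (hit_matrix A)) x /\
  ratfun_eval P (\det (hit_matrix A)) x = hit_lim x B s.
Proof.
move=> BF x01 P; have d0 : rat_eval x (\det (hit_matrix A)) != 0.
  exact: hit_matrix_det_neq0.
split=> //; rewrite /ratfun_eval.
rewrite -[X in X / _]/(rat_eval x P) -[X in _ / X]/(rat_eval x (\det (hit_matrix A))).
apply/(canLR (mulfK d0)).
have hE : map_mx (rat_eval x) (hit_matrix A) *m \col_j hit_lim x B (enum_val j) =
    map_mx (rat_eval x) (hit_target B).
  apply/matrixP => i j; rewrite ord1 hit_matrix_mul !mxE rmorph_nat.
  have [ia|ia] := boolP (active (enum_val i)); last first.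
    by rewrite mul0r subr0 hit_lim_inactive.
  rewrite [X in X - _]hit_lim_rec //; case/andP: ia => -> _.
  by rewrite !mul1r addrK.
have := congr1 (mulmx (map_mx (rat_eval x) (\adj (hit_matrix A)))) hE.
rewrite mulmxA map_mx_adj mul_adj_mx mul_scalar_mx -map_mx_adj -map_mxM.
move/matrixP/(_ (enum_rank s) 0); rewrite [RHS]mxE 2!mxE enum_rankK det_map_mx => <-.
by rewrite mulrC.
Qed.

Lemma simulated_ratfun (R : realType) (D : set R) (f : R -> R) (A : automaton) :
  (D `<=` `]0, 1[)%classic -> (D !=set0)%classic -> (forall p, D p -> 0 < f p < 1) ->
  aut_simulates A D f ->
  exists P Q : {poly rat},
     (forall x : R, 0 < x < 1 ->
        ratfun_defined Q x /\ 0 < ratfun_eval P Q x < 1) /\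
     (forall p, D p -> ratfun_eval P Q p = f p).
Proof.
move=> hD [p0 Dp0] hf [_ [_ sim]].
have D01 p : D p -> 0 < p < 1 by move/hD; rewrite /= in_itv.
have F0 : S0 A \subset final A by exact: finset.subsetUl.
have F1 : S1 A \subset final A by exact: finset.subsetUr.
have L1E p : D p -> hit_lim p (S1 A) (s0 A) = f p.
  move=> Dp; have [_] := sim _ Dp.
  by rewrite (lang_prob_hits (D01 _ Dp) F1 (@aut_lang1E A)) => -[].
(* A point of [D] supplies words for both outputs: without [w1] the value of [f] there would be 0,
   and without [w0] it would be 1. *)
have [w1 w1L] : exists w, hits (S1 A) (s0 A) w.
  apply: contrapT => /forallNP N1; have := hf _ Dp0; rewrite -(L1E _ Dp0) /hit_lim.
  rewrite (_ : (fun n => _) = fun=> 0) ?lim_cst ?ltxx //.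
  apply/funext => n; rewrite hit_probE big1 // => k _.
  by rewrite big1 // => t tL; case: (N1 t).
have [w0 w0L] : exists w, hits (S0 A) (s0 A) w.
  apply: contrapT => /forallNP N0.
  have E : predU (aut_lang A false) (aut_lang A true) =1 hits (S1 A) (s0 A).
    by move=> w /=; rewrite aut_lang0E; case: hits (N0 w) => // /(_ isT).
  have [+ _] := sim _ Dp0; rewrite (lang_prob_hits (D01 _ Dp0) F1 E) L1E // => -[f1].
  by have := hf _ Dp0; rewrite f1 ltxx andbF.
exists ((\adj (hit_matrix A) *m hit_target (S1 A)) (enum_rank (s0 A)) 0).
exists (\det (hit_matrix A)); split=> [x x01|p Dp]; last first.
  by have [_ ->] := hit_lim_ratfun (s0 A) F1 (D01 _ Dp); exact: L1E.
have [? ->] := hit_lim_ratfun (s0 A) F1 x01; split => //.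
(* Outside [D] the two limits are only known to add up to at most 1; positivity of the first still
   keeps the second below 1. *)
have := hit_lim_le1 (s0 A) x01 (subxx (final A)); rewrite -hit_limU //.
have := wprob_le_hit_lim x01 F0 w0L; have := wprob_le_hit_lim x01 F1 w1L.
have := wprob_gt0 w0 x01; have := wprob_gt0 w1 x01.
by move=> *; apply/andP; split; lra.
Qed.

(** * The block automaton *)

(** The harmonic equation iterated [k] times. It holds at final states as well because they are
    absorbing, so words may run past the stopping time. *)
Lemma hit_lim_tuple (R : realType) (A : automaton) (x : R) (B : {set state A}) k s :
  0 < x < 1 -> B \subset final A ->
  hit_lim x B s = \sum_(t : k.-tuple bool) wprob x t * hit_lim x B (run s t).
Proof.
move=> x01 BF.
have harm s' : hit_lim x B s' =
    x * hit_lim x B (delta s' true) + (1 - x) * hit_lim x B (delta s' false).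
  have [sF|sF] := boolP (s' \in final A); last first.
    rewrite hit_lim_rec // sF mul1r (_ : s' \in B = false) ?add0r //.
    by apply: contraNF sF; exact: (fintype.subsetP BF).
  by rewrite !final_absorbing //; ring.
elim: k s => [|k IHk] s.
  rewrite (@sum_tuple0 _ (fun t => wprob x t * hit_lim x B (run s t)) xpredT).
  by rewrite wprob_nil mul1r.
rewrite (@sum_tuple_cons _ _ (fun t => wprob x t * hit_lim x B (run s t)) xpredT).
rewrite harm (IHk (delta s true)) (IHk (delta s false)) !mulr_sumr.
by congr (_ + _); apply: eq_bigr => t _; rewrite wprob_cons mulrA.
Qed.

(** [inr u] stores the part of the current block read so far, and [inl c] is final with output [c].
    Bounded sequences keep the state type finite. *)
Definition block_step (N : nat) (g : seq bool -> option bool)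
    (s : bool + N.-bseq bool) (b : bool) : bool + N.-bseq bool :=
  if s is inr u then
    let v := rcons u b in
    if (size v < N)%N then inr (insub_bseq N v)
    else if g v is Some c then inl c else inr [bseq]
  else s.

Lemma block_disjoint N :
  [disjoint [set (inl false : bool + N.-bseq bool)] & [set (inl true : bool + N.-bseq bool)]].
Proof. by rewrite disjoints1 finset.in_set1. Qed.

Lemma block_absorbing N g (s : bool + N.-bseq bool) b :
  s \in ([set inl false] :|: [set inl true]) -> block_step g s b = s.
Proof. by rewrite finset.in_setU !finset.in_set1 => /orP[] /eqP->. Qed.

(* [g w] is the output after the block [w]; [None] means starting again. *)
Definition block_automaton (N : nat) (g : seq bool -> option bool) : automaton :=
  Automaton (inr [bseq]) (@block_disjoint N) (@block_absorbing N g).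

(** On overlong words [insub_bseq] returns a default value, hence the size conditions here and
    below. *)
Lemma insub_bseqK N (T : Type) (u : seq T) : (size u <= N)%N -> insub_bseq N u = u :> seq T.
Proof. by move=> uN; rewrite /insub_bseq val_insubd uN. Qed.

Lemma run_block_prefix N g (u t : seq bool) : (size (u ++ t) < N)%N ->
  run (A := block_automaton N g) (inr (insub_bseq N u)) t = inr (insub_bseq N (u ++ t)).
Proof.
elim: t u => [|b t IHt] u; first by rewrite cats0.
rewrite -cat_rcons => utN /=; have := utN; rewrite size_cat => utN'.
rewrite insub_bseqK; last by move: utN'; rewrite size_rcons; lia.
by rewrite ifT ?IHt //; lia.
Qed.

Lemma run_block N g (t : seq bool) : (0 < N)%N -> size t = N ->
  run (s0 (block_automaton N g)) t = if g t is Some c then inl c else inr [bseq].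
Proof.
move=> N0; case: (lastP t) => [tN|u b]; first by rewrite -tN in N0.
rewrite size_rcons => uN; rewrite -cats1 /run foldl_cat.
have -> : s0 (block_automaton N g) = inr (insub_bseq N [::]).
  by congr inr; apply: val_inj; rewrite /= insub_bseqK.
(* The first [N - 1] letters only fill the buffer; the last one triggers [g]. *)
rewrite [X in foldl _ X](_ : _ = inr (insub_bseq N u)); last first.
  by rewrite -[RHS](run_block_prefix g (u := [::])) //=; lia.
by rewrite /= cats1 insub_bseqK ?size_rcons ?uN ?ltnn //; lia.
Qed.

Lemma sum_uniq_words (V : nmodType) N (F : seq bool -> V) (L : seq (seq bool)) :
  uniq L -> all (fun w => size w == N) L ->
  \sum_(w <- L) F w = \sum_(t : N.-tuple bool | tval t \in L) F t.
Proof.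
elim: L => [|w L IHL] /=; first by rewrite big_nil big_pred0.
move=> /andP[wL Lu] /andP[wN LN]; rewrite big_cons IHL //.
rewrite [RHS](bigD1 (Tuple wN)) ?mem_head //=; congr (_ + _).
apply: eq_bigl => t; rewrite in_cons -val_eqE /=.
by case: eqP => [->|]; rewrite ?andbT ?andbF // (negPf wL).
Qed.

Lemma block_automaton_hit (R : realType) (N : nat) (x : R) (L : bool -> seq (seq bool)) b :
  let g w := if w \in L true then Some true else
             if w \in L false then Some false else None in
  let A := block_automaton N g in
  let a c := \sum_(w <- L c) wprob x w in
  (0 < N)%N -> 0 < x < 1 ->
  uniq (L true ++ L false) -> (forall c, all (fun w => size w == N) (L c)) ->
  hit_lim x (if b then S1 A else S0 A) (s0 A) * (a true + a false) = a b.
Proof.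
move=> g A a N0 x01; rewrite cat_uniq => /and3P[u1 /hasPn L10 u0] LN.
set B := if b then _ else _.
have BF : B \subset final A.
  by rewrite /B; case: (b); [exact: finset.subsetUr | exact: finset.subsetUl].
have uL c : uniq (L c) by case: c.
have aE c : a c = \sum_(t : N.-tuple bool) (tval t \in L c)%:R * wprob x t.
  rewrite /a (sum_uniq_words _ (uL c) (LN c)) big_mkcond; apply: eq_bigr => t _.
  by case: ifP; rewrite ?mul1r ?mul0r.
have hE c : hit_lim x B (inl c : state A) = (b == c)%:R.
  rewrite hit_lim_rec // (_ : _ \in final A); last first.
    by rewrite /final finset.in_setU /= !finset.in_set1; case: c.
  by rewrite mul0r addr0 /B; case: (b) c => -[]; rewrite /= finset.in_set1.
set h := hit_lim x B (s0 A).
(* Renewal equation from the first block: it outputs [b], outputs the other value, or restarts at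
   [s0]. *)
have : h = a b + (1 - a true - a false) * h.
  rewrite {1}/h (hit_lim_tuple N) // -(sum_wprob_tuple x N) !aE -!sumrB.
  rewrite mulr_suml -big_split; apply: eq_bigr => t _ /=.
  rewrite run_block ?size_tuple // /g.
  have [t1|t1] := boolP (tval t \in L true).
    have t0 : (tval t \in L false) = false by apply/negbTE/negP => /L10 /=; rewrite t1.
    by rewrite hE t0; case: (b); rewrite ?t1 ?t0 /=; ring.
  have [t0|t0] := boolP (tval t \in L false); first rewrite hE;
    by case: (b); rewrite ?(negPf t1) ?(negPf t0) ?t0 -/h /=; ring.
move=> hE'; have -> : a b = h - (1 - a true - a false) * h by rewrite {1}hE' addrK.
ring.
Qed.

(** * Sums of word probabilities *)

(** The suffix records the position of its word in [ws true ++ ws false]. As all original words have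
    length [k], equal padded words have equal suffixes, hence equal positions. *)
Lemma uniq_padding (R : realType) k (ws : bool -> seq (seq bool)) :
  (forall b, all (fun w => size w == k) (ws b)) ->
  exists N M (L : bool -> seq (seq bool)),
    [/\ (0 < N)%N, uniq (L true ++ L false),
        forall b, all (fun w => size w == N) (L b) &
        forall b (x : R), \sum_(w <- L b) wprob x w =
          (x * (1 - x)) ^+ M * \sum_(w <- ws b) wprob x w].
Proof.
(* The successor keeps all positions below [M] and makes the block length positive even for empty
   lists. *)
move=> wsk; pose m b := size (ws b); pose M := (m true + m false).+1.
(* [sfx j] has M zeros and M ones, and its first zero is at position j. *)
pose sfx j := nseq j true ++ nseq M false ++ nseq (M - j) true.
have sfx_size j : (j < M)%N -> size (sfx j) = M.*2.
  by move=> jM; rewrite !size_cat !size_nseq; lia.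
have sfx_prob j (x : R) : (j < M)%N -> wprob x (sfx j) = (x * (1 - x)) ^+ M.
  move=> jM; rewrite /wprob /n1 /n0 !count_cat !count_nseq /= !mul1n !mul0n.
  by rewrite addn0 add0n exprMn; congr (_ ^+ _ * _); lia.
have sfx_index j : index false (sfx j) = j.
  by rewrite index_cat mem_nseq andbF size_nseq /= addn0.
pose pad j := nth [::] (ws true ++ ws false) j ++ sfx j.
pose start b := if b then 0%N else m true.
pose L b := [seq pad j | j <- iota (start b) (m b)].
have nthE b j : (j < m b)%N ->
    nth [::] (ws true ++ ws false) (start b + j) = nth [::] (ws b) j.
  by rewrite nth_cat /start; case: b => /= jm; rewrite ?jm // ltnNge leq_addr /= addKn.
have startM b j : (j < m b)%N -> (start b + j < M)%N.
  by rewrite /start /M; case: b; lia.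
have sizeE b j : (j < m b)%N -> size (nth [::] (ws b) j) = k.
  by move=> jm; apply/eqP; apply: (allP (wsk b)); rewrite mem_nth.
have LE b : L b = [seq nth [::] (ws b) j ++ sfx (start b + j) | j <- iota 0 (m b)].
  rewrite /L -{1}[start b]addn0 iotaDl -map_comp; apply/eq_in_map => j.
  by rewrite mem_iota /= => jm; rewrite /pad nthE.
exists (k + M.*2)%N, M, L; split.
- by rewrite /M; lia.
- rewrite -map_cat -iotaD map_inj_in_uniq ?iota_uniq // => i j.
  rewrite !mem_iota /= add0n => im jm.
  have sz l : (l < m true + m false)%N -> size (nth [::] (ws true ++ ws false) l) = k.
    move=> lm; apply/eqP; move: (mem_nth [::] (s := ws true ++ ws false) (n := l)).
    rewrite size_cat => /(_ lm); rewrite mem_cat => /orP[] /(allP (wsk _)) //.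
  move/eqP; rewrite eqseq_cat ?sz // => /andP[_ /eqP/(congr1 (index false))].
  by rewrite !sfx_index.
- move=> b; rewrite LE all_map; apply/allP => j; rewrite mem_iota /= => jm.
  by rewrite size_cat sizeE ?sfx_size ?startM.
- move=> b x; rewrite LE big_map [in RHS](big_nth [::]) mulr_sumr /index_iota subn0.
  rewrite !big_seq; apply: eq_bigr => j; rewrite mem_iota /= => jm.
  by rewrite wprob_cat sfx_prob ?startM // mulrC.
Qed.

(** The constant [c] clears denominators, and repeated words encode multiplicities. *)
Definition word_sum (R : realType) (F : R -> R) : Prop :=
  exists c k (ws : seq (seq bool)),
    [/\ (0 < c)%N, all (fun w => size w == k) ws &
        forall x, c%:R * F x = \sum_(w <- ws) wprob x w].

Lemma word_sum_cons (R : realType) (F : R -> R) b :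
  word_sum F -> word_sum (fun x => (if b then x else 1 - x) * F x).
Proof.
move=> [c [k [ws [c0 wsk wsE]]]]; exists c, k.+1, (map (cons b) ws); split => //.
  by rewrite all_map; apply: sub_all wsk => w /=.
move=> x; rewrite big_map mulrCA wsE mulr_sumr.
by apply: eq_bigr => w _; rewrite wprob_cons.
Qed.

(** Degree elevation: prefixing each word with either letter preserves the sum, as
    [x + (1 - x) = 1]. *)
Lemma words_raise (R : realType) k j (ws : seq (seq bool)) :
  all (fun w => size w == k) ws ->
  exists2 ws', all (fun w => size w == k + j)%N ws' &
    forall x : R, \sum_(w <- ws') wprob x w = \sum_(w <- ws) wprob x w.
Proof.
move=> wsk; elim: j => [|j [ws' wsk' wsE]]; first by exists ws; rewrite ?addn0.
exists (map (cons true) ws' ++ map (cons false) ws').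
  by rewrite addnS all_cat !all_map; apply/andP; split; apply: sub_all wsk' => w /=.
move=> x; rewrite big_cat !big_map /= -wsE -big_split; apply: eq_bigr => w _ /=.
by rewrite !wprob_cons; ring.
Qed.

Lemma words_scale (R : realType) k c (ws : seq (seq bool)) :
  all (fun w => size w == k) ws ->
  exists2 ws', all (fun w => size w == k) ws' &
    forall x : R, \sum_(w <- ws') wprob x w = c%:R * \sum_(w <- ws) wprob x w.
Proof.
move=> wsk; elim: c => [|c [ws' wsk' wsE]].
  by exists [::] => // x; rewrite big_nil mul0r.
exists (ws ++ ws'); first by rewrite all_cat wsk.
by move=> x; rewrite big_cat /= wsE -natr1; ring.
Qed.

(** Cross-multiplication: each list is lengthened by the other's word length and repeated by the
    other's constant. *)
Lemma word_sum_common (R : realType) (F : bool -> R -> R) :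
  (forall b, word_sum (F b)) ->
  exists c k (ws : bool -> seq (seq bool)),
    [/\ (0 < c)%N, forall b, all (fun w => size w == k) (ws b) &
        forall b x, c%:R * F b x = \sum_(w <- ws b) wprob x w].
Proof.
move=> FW; have [c1 [k1 [ws1 [c10 wsk1 wsE1]]]] := FW true.
have [c0 [k0 [ws0 [c00 wsk0 wsE0]]]] := FW false.
have [v1 vk1 vE1] := words_raise R k0 wsk1; have [v0 vk0 vE0] := words_raise R k1 wsk0.
have [u1 uk1 uE1] := words_scale R c0 vk1; have [u0 uk0 uE0] := words_scale R c1 vk0.
exists (c1 * c0)%N, (k1 + k0)%N, (fun b => if b then u1 else u0); split.
- by rewrite muln_gt0 c10.
- by case=> //; rewrite addnC.
- by case=> x; rewrite ?uE1 ?uE0 ?vE1 ?vE0 -?wsE1 -?wsE0 natrM; ring.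
Qed.

(** * Common denominators and falling factorials *)

Lemma common_denominator n (q : nat -> rat) :
  (forall i, (i < n)%N -> 0 <= q i) ->
  exists c (d : nat -> nat), (0 < c)%N /\
    forall i, (i < n)%N -> c%:R * q i = (d i)%:R.
Proof.
elim: n => [|n IHn] q0; first by exists 1%N, id.
have [|c [d [c0 dE]]] := IHn; first by move=> i /ltnW/q0.
pose e := `|denq (q n)|%N.
exists (c * e)%N, (fun i => if i == n then c * `|numq (q n)| else d i * e)%N.
split=> [|i]; first by rewrite muln_gt0 c0 absz_gt0 denq_neq0.
rewrite ltnS leq_eqVlt natrM; case: eqP => [-> _|_ /= i_n]; last first.
  by rewrite natrM mulrAC dE.
rewrite natrM -mulrA; congr (_ * _).
have -> : e%:R = (denq (q n))%:~R :> rat by rewrite -[in RHS]absz_denq.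
rewrite mulrC -numqE -{1}(gez0_abs (_ : 0 <= numq (q n))) //.
by rewrite numq_ge0 q0.
Qed.

(** Factorial moments of the binomial distribution, by absorbing [i] into the binomial coefficient.
    With [y = 1 - x] they expand the monomial [x ^+ j] in the Bernstein basis of degree [n]. *)
Lemma binomial_factorial_moment (R : comPzRingType) (x y : R) n j :
  \sum_(i < n.+1) ('C(n, i) * i ^_ j)%:R * (x ^+ i * y ^+ (n - i)) =
  (n ^_ j)%:R * (x ^+ j * (x + y) ^+ (n - j)).
Proof.
elim: j n => [|j IHj] n.
  rewrite ffactn0 expr0 !mul1r subn0 addrC exprDn; apply: eq_bigr => i _.
  by rewrite ffactn0 muln1 mulr_natl mulrC.
case: n => [|n]; first by rewrite big_ord1 ffactnS /= muln0 !mul0r.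
rewrite big_ord_recl ffactnS mul0n muln0 mul0r add0r.
rewrite (eq_bigr (fun i : 'I_n.+1 => n.+1%:R * x *
  (('C(n, i) * i ^_ j)%:R * (x ^+ i * y ^+ (n - i))))) => [|i _].
  by rewrite -mulr_sumr IHj ffactSS subSS natrM exprS; ring.
rewrite lift0 subSS ffactSS mulnA [('C(_, _) * _)%N]mulnC -mul_bin_diag.
by rewrite !natrM exprS; ring.
Qed.

(** The ratio is a product of factors [(i - l) / (n - l)] for [l < j], each in [0, 1] and within
    [l / n] of [i / n]; the errors add up. *)
Lemma ffact_ratio_approx (R : realFieldType) n i j : (i <= n)%N -> (j <= n)%N -> (0 < n)%N ->
  [/\ 0 <= (i ^_ j)%:R / (n ^_ j)%:R :> R, (i ^_ j)%:R / (n ^_ j)%:R <= 1 :> R &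
  `|(i ^_ j)%:R / (n ^_ j)%:R - (i%:R / n%:R) ^+ j| <= (j * j)%:R / n%:R :> R].
Proof.
move=> i_n + n0; have n0' : 0 < n%:R :> R by rewrite ltr0n.
have in1 : i%:R / n%:R <= 1 :> R by rewrite ler_pdivrMr // mul1r ler_nat.
have in0 : 0 <= i%:R / n%:R :> R by rewrite divr_ge0 ?ler0n.
elim: j => [|j IHj] jn.
  by rewrite !ffactn0 divr1 expr0 subrr normr0 mul0r; split.
have [u0 u1 uv] := IHj (ltnW jn).
have nj0 : 0 < (n - j)%:R :> R by rewrite ltr0n subn_gt0.
have r0 : 0 <= (i - j)%:R / (n - j)%:R :> R by rewrite divr_ge0 ?ler0n.
have r1 : (i - j)%:R / (n - j)%:R <= 1 :> R.
  by rewrite ler_pdivrMr // mul1r ler_nat leq_sub2r.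
have rE : `|(i - j)%:R / (n - j)%:R - i%:R / n%:R| <= j%:R / n%:R :> R.
  (* Subtraction is truncated: for [i <= j] the factor is 0 and the error is [i / n] itself. *)
  have [ij|ji] := leqP i j.
    rewrite (eqP ij) mul0r sub0r normrN ger0_norm //.
    by rewrite ler_pM2r ?invr_gt0 // ler_nat.
  have Dnj : n%:R = (n - j)%:R + j%:R :> R by rewrite -natrD subnK // ltnW.
  have Dij : i%:R = (i - j)%:R + j%:R :> R by rewrite -natrD subnK // ltnW.
  have -> : (i - j)%:R / (n - j)%:R - i%:R / n%:R =
      j%:R * ((i - j)%:R / (n - j)%:R - 1) / n%:R :> R.
    have n0'' : n%:R != 0 :> R by rewrite gt_eqF.
    rewrite Dnj Dij; field; rewrite -Dnj n0'' /=.
    by rewrite gt_eqF.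
  rewrite !normrM normfV (gtr0_norm n0') normr_nat ler_pM2r ?invr_gt0 //.
  by rewrite -[leRHS]mulr1 ler_wpM2l // ler_norml; apply/andP; split; lra.
rewrite !ffactnSr (natrM _ (i ^_ j)) (natrM _ (n ^_ j)) exprSr -mulf_div.
set u := (i ^_ j)%:R / _ in u0 u1 uv *; set r := (i - j)%:R / _ in r0 r1 rE *.
set v := i%:R / _ in in1 in0 rE uv *.
split; [exact: mulr_ge0 | by rewrite -[1]mul1r ler_pM | ].
have v1 : v ^+ j <= 1 by rewrite exprn_ile1.
have v0 : 0 <= v ^+ j by rewrite exprn_ge0.
apply: (@le_trans _ _ ((j * j)%:R / n%:R + j%:R / n%:R)); last first.
  by rewrite -mulrDl -natrD ler_pM2r ?invr_gt0 // ler_nat; lia.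
rewrite (_ : _ - _ = (u - v ^+ j) * v + u * (r - v)); last by ring.
apply: (le_trans (ler_normD _ _)); rewrite (normrM (u - _)) (normrM u); apply: lerD.
  by rewrite (ger0_norm in0) -[leRHS]mulr1 ler_pM.
by rewrite (ger0_norm u0) -[leRHS]mul1r ler_pM.
Qed.

(** * Bernstein expansions *)

Lemma rat_evalE (R : realType) (x : R) (P : {poly rat}) :
  rat_eval x P = \sum_(j < size P) ratr P`_j * x ^+ j.
Proof.
rewrite /= /horner_eval horner_coef size_map_poly.
by apply: eq_bigr => j _; rewrite coef_map.
Qed.

(** The [i]-th Bernstein coefficient of [P] in degree [n], close to the value of [P] at [i / n] when
    [n] is large. *)
Definition bernstein_ratio (P : {poly rat}) n i : rat :=
  \sum_(j < size P) P`_j * ((i ^_ j)%:R / (n ^_ j)%:R).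

Lemma bernstein_ratioE (R : realType) (P : {poly rat}) n i :
  ratr (bernstein_ratio P n i) =
  \sum_(j < size P) ratr P`_j * ((i ^_ j)%:R / (n ^_ j)%:R) :> R.
Proof.
rewrite rmorph_sum; apply: eq_bigr => j _.
by rewrite rmorphM fmorph_div !rmorph_nat.
Qed.

Lemma bernstein_expansion (R : realType) (P : {poly rat}) n (x : R) :
  (size P <= n)%N ->
  rat_eval x P = \sum_(i < n.+1) ratr (bernstein_ratio P n i) *
    ('C(n, i)%:R * (x ^+ i * (1 - x) ^+ (n - i))).
Proof.
move=> Pn; rewrite rat_evalE.
under [RHS]eq_bigr do rewrite bernstein_ratioE mulr_suml.
rewrite exchange_big; apply: eq_bigr => j _ /=.
have nj0 : (n ^_ j)%:R != 0 :> R.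
  by rewrite pnatr_eq0 -lt0n ffact_gt0 (leq_trans (ltnW (ltn_ord j))).
have := binomial_factorial_moment x (1 - x) n j.
rewrite [X in X ^+ (n - j)](_ : _ = 1) ?expr1n ?mulr1; last by ring.
move/(canLR (mulKf nj0)) => <-; rewrite !mulr_sumr; apply: eq_bigr => i _.
by rewrite natrM; ring.
Qed.

(** By compactness [P] has a minimum [m > 0] on [0, 1]. The coefficients differ from the values at
    [i / n] by at most [K * J ^ 2 / n], uniformly in [i], which is at most [m] for large [n]. *)
Lemma bernstein_ratio_ge0 (R : realType) (P : {poly rat}) :
  (forall x : R, 0 <= x <= 1 -> 0 < rat_eval x P) ->
  exists2 n, (size P <= n)%N & forall i, (i <= n)%N -> 0 <= bernstein_ratio P n i.
Proof.
move=> P0; have cP : {within `[0 : R, 1], continuous (fun x => rat_eval x P)}%classic.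
  by apply: continuous_subspaceT => x; exact: continuous_horner.
have [z z01 zmin] := EVT_min ler01 cP; set m := rat_eval z P in zmin.
have m0 : 0 < m by apply: P0; move: z01; rewrite in_itv.
pose J := size P; pose K : R := \sum_(j < J) `|ratr P`_j|.
have K0 : 0 <= K by rewrite sumr_ge0.
pose b := K * (J * J)%:R / m.
have b0 : 0 <= b by rewrite divr_ge0 ?mulr_ge0 ?ler0n // ltW.
(* The summand [J] gives [size P <= n]; the other puts [n] above [b], the threshold for the error to
   be at most [m]. *)
pose n := (J + (Num.bound b).+1)%N; exists n; first exact: leq_addr.
move=> i i_n; have n0 : (0 < n)%N by rewrite /n; lia.
have n0' : 0 < n%:R :> R by rewrite ltr0n.
have Kn : K * (J * J)%:R / n%:R <= m.
  rewrite ler_pdivrMr // -ler_pdivrMl // [leLHS]mulrC -/b.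
  apply: le_trans (ltW (archi_boundP b0)) _; rewrite ler_nat /n; lia.
rewrite -(ler0q R) bernstein_ratioE.
have in01 : 0 <= (i%:R / n%:R : R) <= 1.
  by rewrite divr_ge0 ?ler0n //= ler_pdivrMr // mul1r ler_nat.
have : m <= rat_eval (i%:R / n%:R) P by apply: zmin; rewrite in_itv.
rewrite rat_evalE -/J; set s := \sum_(j < J) _ => ms; set t := \sum_(j < J) _.
suff : `|t - s| <= m by rewrite ler_norml => /andP[+ _]; lra.
apply: le_trans Kn; rewrite /t /s -sumrB -mulrA mulr_suml.
apply: (le_trans (ler_norm_sum _ _ _)); apply: ler_sum => j _.
rewrite -mulrBr normrM ler_wpM2l //.
have jn : (j <= n)%N by have := ltn_ord j; rewrite /n; lia.
have [_ _ /le_trans->] // := @ffact_ratio_approx R n i j i_n jn n0.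
by rewrite ler_pM2r ?invr_gt0 // ler_nat leq_mul // ltnW.
Qed.

(** * From positive polynomials to word sums *)

Lemma word_sum_pos_closed (R : realType) (P : {poly rat}) :
  (forall x : R, 0 <= x <= 1 -> 0 < rat_eval x P) ->
  word_sum (fun x : R => rat_eval x P).
Proof.
move=> /bernstein_ratio_ge0[n Pn b0].
have [c [d [c0 dE]]] := common_denominator (n := n.+1) b0.
(* Only the number of ones matters for the probability, so copies of one word per [i] suffice;
   padding separates them later. *)
exists c, n, (flatten [seq nseq (d i * 'C(n, i))%N (nseq i true ++ nseq (n - i) false)
  | i <- iota 0 n.+1]); split=> //.
  apply/allP => w /flatten_mapP[i]; rewrite mem_iota add0n ltnS /= => i_n.
  by rewrite mem_nseq => /andP[_ /eqP->]; rewrite size_cat !size_nseq subnKC.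
move=> x; rewrite (bernstein_expansion x Pn) mulr_sumr big_flatten big_map.
rewrite -[iota 0 n.+1]/(index_iota 0 n.+1) big_mkord; apply: eq_bigr => i _.
rewrite big_nseq iter_addr_0 [LHS]mulrA.
have -> : c%:R * ratr (bernstein_ratio P n i) = (d i)%:R :> R.
  by rewrite -(rmorph_nat (@ratr R)) -rmorphM dE ?rmorph_nat.
rewrite /wprob /n1 /n0 !count_cat !count_nseq /= !mul1n !mul0n addn0 add0n.
by rewrite -[RHS]mulr_natl natrM; ring.
Qed.

(** A negative value at [a] would force a root between [a] and 1/2. The root differs from [a], so it
    lies in the open interval, where [P] is positive. *)
Lemma rat_eval_gt0_endpoint (R : realType) (P : {poly rat}) (a : R) :
  (forall x : R, 0 < x < 1 -> 0 < rat_eval x P) ->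
  0 <= a <= 1 -> rat_eval a P != 0 -> 0 < rat_eval a P.
Proof.
move=> P0 /andP[a0 a1] aP; rewrite lt_neqAle eq_sym aP leNgt; apply/negP => aN.
have h0 : 0 < rat_eval (2^-1 : R) P by apply: P0; lra.
pose p := map_poly (ratr : rat -> R) P.
have noroot c : 0 <= c <= 1 -> (c < a -> 0 < c) -> (a < c -> c < 1) -> ~ root p c.
  move=> /andP[c0 c1] ca ac /eqP pc; have {}pc : rat_eval c P = 0 := pc.
  have [ca'|ac'|cE] := ltgtP c a.
  - by have := P0 c; rewrite ca // (lt_le_trans ca') // => /(_ isT); rewrite pc ltxx.
  - by have := P0 c; rewrite ac // (le_lt_trans a0) // => /(_ isT); rewrite pc ltxx.
  - by move/eqP: aP; rewrite -cE; apply.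
have [ah|ha] := leP a 2^-1.
  have [|c /andP[ac ch]] := poly_ivt (p := p) ah; first by rewrite (ltW aN) (ltW h0).
  by apply: noroot => [|?|?]; lra.
(* [poly_ivt] wants a sign change from negative to positive, hence [- p] when [a] is to the
   right. *)
have [|c /andP[hc ca]] := poly_ivt (p := - p) (ltW ha).
  by rewrite !hornerN !oppr_le0 oppr_ge0 (ltW aN) (ltW h0).
by rewrite rootN; apply: noroot => [|?|?]; lra.
Qed.

(** Induction on the size: a root at 0 or 1 splits off ['X] or [1 - 'X], which amounts to prefixing
    a letter to every word. With no such root, [P] is positive on the closed interval. *)
Lemma word_sum_pos (R : realType) (P : {poly rat}) :
  (forall x : R, 0 < x < 1 -> 0 < rat_eval x P) -> word_sum (fun x : R => rat_eval x P).
Proof.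
have [n] := ubnP (size P); elim: n P => // n IHn P Pn P0.
have Pnz : P != 0.
  apply/eqP => PE; have : 0 < rat_eval (2^-1 : R) P by apply: P0; lra.
  by rewrite PE rmorph0 ltxx.
have red Q b : P = Q * (if b then 'X else 1 - 'X) -> word_sum (fun x : R => rat_eval x P).
  move=> PE; have Qnz : Q != 0 by apply: contraNneq Pnz => Q0; rewrite PE Q0 mul0r.
  have evE (x : R) : rat_eval x P = (if b then x else 1 - x) * rat_eval x Q.
    by rewrite PE rmorphM mulrC; case: b {PE}; rewrite ?rmorphB ?rmorph1 rat_evalX.
  have [||c [k [ws [c0 wsk wsE]]]] := word_sum_cons b (IHn Q _ _).
  - move: Pn; rewrite PE size_mul //; last first.
      by apply: contraNneq Pnz => Q0; rewrite PE Q0 mulr0.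
    have -> : size (if b then 'X else 1 - 'X : {poly rat}) = 2%N.
      by case: b {PE evE}; rewrite ?size_polyX // -opprB size_polyN -polyC1 size_XsubC.
    by rewrite addn2 ltnS.
  - move=> x x01; have := P0 x x01; rewrite evE pmulr_rgt0 //.
    by case: b {PE evE}; lra.
  - by exists c, k, ws; split => // x; rewrite evE wsE.
have [/factor_theorem[Q]|r0] := boolP (root P 0).
  by rewrite subr0; exact: (red Q true).
have [/factor_theorem[Q PE]|r1] := boolP (root P 1).
  by apply: (red (- Q) false); rewrite PE polyC1 mulNr -mulrN opprB.
apply: word_sum_pos_closed => x /andP[x0 x1].
(* The endpoints are rational, so being a root can be tested over [rat]. *)
have eN (a : rat) : ~~ root P a -> rat_eval (ratr a : R) P != 0.
  by move=> Pa; rewrite /= /horner_eval horner_map fmorph_eq0.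
have := eN 0 r0; have := eN 1 r1; rewrite rmorph0 rmorph1 => e1 e0.
move: x0; rewrite le_eqVlt => /predU1P[<-|x0].
  by apply: rat_eval_gt0_endpoint => //; rewrite lexx ler01.
move: x1; rewrite le_eqVlt => /predU1P[->|x1]; last by apply: P0; rewrite x0.
by apply: rat_eval_gt0_endpoint => //; rewrite lexx ler01.
Qed.

(** * Assembly of the simulating automaton *)

Lemma ratfun_simulated (R : realType) (D : set R) (f : R -> R) (P Q : {poly rat}) :
  (D `<=` `]0, 1[)%classic ->
  (forall x : R, 0 < x < 1 -> ratfun_defined Q x /\ 0 < ratfun_eval P Q x < 1) ->
  (forall p, D p -> ratfun_eval P Q p = f p) ->
  exists A : automaton, aut_simulates A D f.
Proof.
(* The factor [Q] removes its unknown sign: both polynomials are positive on (0, 1), and they add up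
   to [Q ^+ 2]. *)
move=> hD PQ01 PQf; pose F b := if b then P * Q else Q ^+ 2 - P * Q.
have evF (x : R) : 0 < x < 1 ->
    rat_eval x (F true) = ratfun_eval P Q x * rat_eval x Q ^+ 2 /\
    rat_eval x (F false) = (1 - ratfun_eval P Q x) * rat_eval x Q ^+ 2.
  move=> /PQ01[Q0 _]; have {}Q0 : rat_eval x Q != 0 := Q0.
  rewrite /ratfun_eval rmorphB !rmorphM -[_.[x]]/(rat_eval x P).
  rewrite -[X in _ / X]/(rat_eval x Q).
  by split; field.
have Q2 (x : R) : 0 < x < 1 -> 0 < rat_eval x Q ^+ 2.
  by move=> /PQ01[Q0 _]; rewrite exprn_even_gt0.
have Fpos b (x : R) : 0 < x < 1 -> 0 < rat_eval x (F b).
  move=> x01; have [E1 E0] := evF x x01; have [_ /andP[r0 r1]] := PQ01 x x01.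
  by case: b; rewrite ?E1 ?E0 mulr_gt0 ?subr_gt0 ?Q2.
have [c [k [ws [c0 wsk wsE]]]] :=
  word_sum_common (fun b => word_sum_pos (Fpos b)).
have [N [M [L [N0 Lu LN LE]]]] := uniq_padding R wsk.
pose A := block_automaton N (fun w => if w \in L true then Some true else
             if w \in L false then Some false else None).
have hitE p b : D p -> hit_lim p (if b then S1 A else S0 A) (s0 A) =
    if b then f p else 1 - f p.
  move=> Dp; have p01 : 0 < p < 1 by move/hD: Dp; rewrite /= in_itv.
  have := block_automaton_hit b N0 p01 Lu LN.
  rewrite !LE -!wsE; have [-> E0] := evF p p01; rewrite E0.
  have -> : rat_eval p (F b) = (if b then f p else 1 - f p) * rat_eval p Q ^+ 2.
    by case: b; rewrite -PQf // (evF p p01).1 || rewrite -PQf // E0.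
  (* The total weight of the two lists, by which the renewal identity is divided. *)
  have q0 : (p * (1 - p)) ^+ M * (c%:R * rat_eval p Q ^+ 2) != 0.
    have [Q0 _] := PQ01 p p01; case/andP: p01 => p0 p1.
    rewrite !mulf_neq0 //; last by rewrite pnatr_eq0 -lt0n.
    by rewrite expf_neq0 // mulf_neq0 // gt_eqF ?subr_gt0.
  rewrite -/A; set h := hit_lim _ _ _; set v := if b then _ else _ => E.
  apply: (mulIf q0); transitivity ((p * (1 - p)) ^+ M * (c%:R * (v * rat_eval p Q ^+ 2))).
    by rewrite -E; ring.
  by ring.
exists A; split; first exact: aut_lang_disjoint.
split; first exact: aut_lang_prefix_free.
move=> p Dp; have p01 : 0 < p < 1 by move/hD: Dp; rewrite /= in_itv.
split.
  rewrite (lang_prob_hits p01 (subxx _) (@aut_langUE A)) -hit_limU //.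
  by rewrite (hitE p true) // (hitE p false) // subrK.
by rewrite (lang_prob_hits p01 (finset.subsetUr _ _) (@aut_lang1E A)) (hitE p true).
Qed.

Local Open Scope classical_set_scope.

Theorem theorem1 (R : realType) (D : set R) (f : R -> R)
  (hD : D `<=` `]0, 1[%classic) (hDne : D !=set0)
  (hf : forall p, D p -> 0 < f p < 1) :
  (exists A : automaton, aut_simulates A D f) <->
  (exists P Q : {poly rat},
     (forall x : R, 0 < x < 1 ->
        ratfun_defined Q x /\ 0 < ratfun_eval P Q x < 1) /\
     (forall p, D p -> ratfun_eval P Q p = f p)).
Proof.
split=> [[A]|[P [Q [PQ01 PQf]]]]; first exact: simulated_ratfun.
exact: ratfun_simulated PQf.
Qed.
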